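(* Let $\mathcal{H}_k$ be an analytic tridiagonal space with kernel $k$ corresponding to the orthonormal basis $\{f_n\}_{n\ge 0}$, where $f_n(z)=(a_n+b_nz)z^n$, $n\ge 0$. Let $L$ be the bounded linear operator on $\mathcal{H}_k$ whose matrix $(\ell_{mn})_{m,n\ge 0}$, $\ell_{mn}=\langle Lf_n,f_m\rangle$, with respect to $\{f_n\}_{n\geq 0}$ is $$\ell_{mn}=\begin{cases}\dfrac{a_{m+1}}{a_m} & n=m+1,\\[2mm] d_m & n=m\ge 1,\\[1mm] (-1)^{m-n}\,\dfrac{d_n\,b_nb_{n+1}\cdots b_{m-1}}{a_{n+1}a_{n+2}\cdots a_m} & 1\le n<m,\\[2mm] 0 & \text{otherwise,}\end{cases}$$ where $d_n=\frac{b_n}{a_n}-\frac{b_{n-1}}{a_{n-1}}$ for $n\ge 1$. Then $L M_z=I_{\mathcal{H}_k}$, where $M_z$ is the shift on $\mathcal{H}_k$.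
   Context: $\mathbb{D}$ is the open unit disc, $\mathcal{O}(\mathbb{D})$ the space of analytic functions on $\mathbb{D}$. For a positive definite scalar kernel $k$ on $\mathbb{D}$, analytic in the first variable, $\mathcal{H}_k$ is its reproducing kernel Hilbert space of analytic functions, and the shift $M_z$ is $(M_zf)(w)=wf(w)$. A semi-analytic tridiagonal space is such an $\mathcal{H}_k$ with $\mathbb{C}[z]\subseteq\mathcal{H}_k\subseteq\mathcal{O}(\mathbb{D})$ for which there are complex scalars $\{a_n\}_{n\ge 0}$, $\{b_n\}_{n\ge 0}$ with $a_n\ne 0$ for all $n$, $\sup_{n}|a_n/a_{n+1}|<\infty$, $\limsup_{n}|b_n/a_{n+1}|<1$, and such that $f_n(z)=(a_n+b_nz)z^n$, $n\ge 0$, form an orthonormal basis of $\mathcal{H}_k$ (so $k(z,w)=\sum_{n\ge0}f_n(z)\overline{f_n(w)}$). These conditions ensure that $M_z$ is bounded on $\mathcal{H}_k$. It is an analytic tridiagonal space (and $k$ an analytic tridiagonal kernel) if in addition $\{|a_n/a_{n+1}|\}_{n\ge 0}$ is bounded away from zero. The paper establishes separately that under these assumptions the matrix $(\ell_{mn})$ does define a bounded operator. *)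

(* Defs.v *)
From Stdlib Require Import Reals List Arith.
From Coquelicot Require Import Coquelicot.

Open Scope C_scope.

Definition disc (z : C) : Prop := (Cmod z < 1)%R.

(** Functions on the disc are represented by total functions [C -> C]; only
    their values on [disc] are ever used. The disc being open, complex
    differentiability at its points does not depend on the values outside. *)
Definition analytic_on_disc (f : C -> C) : Prop :=
  forall z, disc z -> ex_derive (K := C_AbsRing) (V := C_NormedModule) f z.

Definition positive_definite_kernel (k : C -> C -> C) : Prop :=
  forall (N : nat) (w c : nat -> C),
    (forall i, disc (w i)) ->
    let s := sum_n (fun i => sum_n (fun j =>
               Cconj (c i) * c j * k (w i) (w j)) N) N in
    Im s = 0%R /\ (0 <= Re s)%R.

Definition analytic_in_first_variable (k : C -> C -> C) : Prop :=
  forall w, disc w -> analytic_on_disc (fun z => k z w).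

(** The reproducing kernel Hilbert space of [k] on the disc: a complex Hilbert
    space whose vectors are, through the injective map [eval], functions on the
    disc. The inner product is linear in its first argument. *)
Record RKHS (k : C -> C -> C) : Type := {
  space :> CompleteNormedModule C_AbsRing;
  inner : space -> space -> C;
  inner_plus : forall f g h, inner (plus f g) h = inner f h + inner g h;
  inner_scal : forall c f g, inner (scal c f) g = c * inner f g;
  inner_conj : forall f g, inner g f = Cconj (inner f g);
  inner_norm : forall f, inner f f = RtoC (norm f ^ 2);
  eval : space -> C -> C;
  eval_plus : forall f g z, disc z -> eval (plus f g) z = eval f z + eval g z;
  eval_scal : forall c f z, disc z -> eval (scal c f) z = c * eval f z;
  eval_inj : forall f g, (forall z, disc z -> eval f z = eval g z) -> f = g;
  reproducing : forall w, disc w ->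
    exists kw : space,
      (forall z, disc z -> eval kw z = k z w) /\
      (forall f, eval f w = inner f kw)
}.

Arguments inner {k r} _ _.
Arguments eval {k r} _ _.

Definition orthonormal_basis {k : C -> C -> C} {H : RKHS k} (e : nat -> H) : Prop :=
  (forall m n, inner (e m) (e n) = if Nat.eq_dec m n then 1 else 0) /\
  (forall (g : H) (eps : R), (0 < eps)%R ->
     exists (N : nat) (c : nat -> C),
       (norm (minus g (sum_n (fun n => scal (c n) (e n)) N)) < eps)%R).

Definition contains_polynomials {k : C -> C -> C} (H : RKHS k) : Prop :=
  forall (N : nat) (c : nat -> C),
    exists p : H, forall z, disc z -> eval p z = sum_n (fun i => c i * z ^ i) N.

Record semi_analytic_tridiagonal {k : C -> C -> C} (H : RKHS k)
    (a b : nat -> C) (f : nat -> H) : Prop := {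
  sat_polynomials : contains_polynomials H;
  sat_analytic : forall g : H, analytic_on_disc (eval g);
  sat_nonzero : forall n, a n <> 0;
  sat_sup : exists M : R, forall n, (Cmod (a n / a (S n)) <= M)%R;
  sat_limsup : Rbar_lt (LimSup_seq (fun n => Cmod (b n / a (S n)))) (Finite 1);
  sat_eval : forall n z, disc z -> eval (f n) z = (a n + b n * z) * z ^ n;
  sat_basis : orthonormal_basis f
}.

Definition analytic_tridiagonal {k : C -> C -> C} (H : RKHS k)
    (a b : nat -> C) (f : nat -> H) : Prop :=
  semi_analytic_tridiagonal H a b f /\
  exists eps : R, (0 < eps)%R /\ forall n, (eps <= Cmod (a n / a (S n)))%R.

(** [Cprod u i l] is the product [u i * u (i + 1) * ... * u (i + l - 1)]. *)
Definition Cprod (u : nat -> C) (i l : nat) : C :=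
  fold_right Cmult 1 (map u (seq i l)).

(** Only used for [1 <= n]. *)
Definition d_coef (a b : nat -> C) (n : nat) : C :=
  b n / a n - b (n - 1)%nat / a (n - 1)%nat.

Definition ell (a b : nat -> C) (m n : nat) : C :=
  if Nat.eq_dec n (S m) then a (S m) / a m
  else if Nat.eq_dec n 0 then 0
  else if Nat.eq_dec n m then d_coef a b m
  else if lt_dec n m then
    (- (1)) ^ (m - n) * (d_coef a b n * Cprod b n (m - n))
      / Cprod a (S n) (m - n)
  else 0.

(** By [eval_inj] there is at most one such [M]. *)
Definition is_shift {k : C -> C -> C} {H : RKHS k} (M : H -> H) : Prop :=
  forall g z, disc z -> eval (M g) z = z * eval g z.

(* Main.v *)
From Stdlib Require Import Reals Arith Lra Lia ClassicalEpsilon.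
From Coquelicot Require Import Coquelicot.
Require Import Defs.

(** Everything is read off coordinates in the orthonormal basis [f].

    If [g] has coordinates [c n], then on the disc [eval g] is the power series
    whose coefficients are [a n * c n + b (n - 1) * c (n - 1)], terms of index
    [- 1] being [0] ([is_series_taylor]). Multiplying by [z] moves these
    coefficients one place up, so the coordinates [h n] of [z * g] must satisfy
    [h 0 = 0] and

      [a (n + 1) * h (n + 1) + b n * h n = a n * c n + b (n - 1) * c (n - 1)].

    This can be solved by forward substitution, whatever the sequence [c]. The
    solution [shift_coef a b c] is square summable: the recursion contracts by
    [|b n / a (n + 1)|], eventually at most some [r < 1], and is driven by a
    square summable term, because [|a n / a (n + 1)|] is bounded
    ([square_summable_shift_coef]). The vector with these coordinates is
    therefore in the space, and it is [z * g] ([eval_shift]). So the shift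
    is defined on the whole space.

    For the left inverse, each row of the matrix of [L] has finitely many
    nonzero entries, and row [m + 1] is, up to its last two entries,
    [- (b m / a (m + 1))] times row [m] ([ell_step]). By induction on [m] the
    recursion for [h] then gives that row [m] of the matrix maps [h] to
    [c m] ([ell_row]). As [L] is bounded, the coordinates of [L (z * g)] may be
    computed by these finite sums, and they are those of [g]. *)

Local Open Scope C_scope.

(** Sums and series produce the operations of abstract structures; [ring]
    knows those of [C]. *)
Ltac ring_C :=
  lazymatch goal with |- ?x = ?y => change (@eq C x y) end;
  repeat match goal with
    | |- context [@plus ?G ?x ?y] => change (@plus G x y) with (Cplus x y)
    | |- context [@minus ?G ?x ?y] => change (@minus G x y) with (Cminus x y)
    | |- context [@zero ?G] => change (@zero G) with (RtoC 0)
  end; ring.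

(** * Inner products *)

Lemma inner_plus_r {k : C -> C -> C} {H : RKHS k} (f g h : H) :
  inner f (plus g h) = inner f g + inner f h.
Proof.
  rewrite (inner_conj _ _ (plus g h)), inner_plus, Cplus_conj.
  now rewrite <- !inner_conj.
Qed.

Lemma inner_scal_r {k : C -> C -> C} {H : RKHS k} (c : C) (f g : H) :
  inner f (scal c g) = Cconj c * inner f g.
Proof.
  rewrite (inner_conj _ _ (scal c g)), inner_scal, Cmult_conj.
  now rewrite <- inner_conj.
Qed.

Lemma inner_zero_l {k : C -> C -> C} {H : RKHS k} (g : H) :
  inner (zero : H) g = 0.
Proof.
  replace (inner (zero : H) g) with (inner (scal (RtoC 0) (zero : H)) g).
  - rewrite inner_scal. ring.
  - f_equal. exact (scal_zero_l (V := H) zero).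
Qed.

Lemma inner_0_sym {k : C -> C -> C} {H : RKHS k} (f g : H) :
  inner f g = 0 -> inner g f = 0.
Proof.
  intros fg. rewrite inner_conj, fg. unfold Cconj. simpl. now rewrite Ropp_0.
Qed.

Lemma inner_minus {k : C -> C -> C} {H : RKHS k} (f g h : H) :
  inner (minus f g) h = inner f h - inner g h.
Proof.
  unfold minus. rewrite inner_plus.
  replace (inner (opp g) h) with (inner (scal (- (1)) g) h).
  - rewrite inner_scal. ring.
  - f_equal. exact (scal_opp_one (V := H) g).
Qed.

Lemma minus_plus_cancel {k : C -> C -> C} {H : RKHS k} (f g : H) :
  plus (minus f g) g = f.
Proof.
  transitivity (plus f (plus (opp g) g)); [symmetry; exact (plus_assoc f _ _) |].
  rewrite (plus_opp_l (G := H) g). exact (plus_zero_r f).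
Qed.

Lemma pythagoras {k : C -> C -> C} {H : RKHS k} (f g : H) :
  inner f g = 0 -> (norm (plus f g) ^ 2 = norm f ^ 2 + norm g ^ 2)%R.
Proof.
  intros fg. apply RtoC_inj.
  rewrite RtoC_plus, <- !inner_norm, inner_plus, !inner_plus_r.
  rewrite fg, (inner_0_sym _ _ fg). ring.
Qed.

Lemma pythagoras_minus {k : C -> C -> C} {H : RKHS k} (f g : H) :
  inner (minus f g) g = 0 ->
  (norm f ^ 2 = norm (minus f g) ^ 2 + norm g ^ 2)%R.
Proof.
  intros orth. transitivity (norm (plus (minus f g) g) ^ 2)%R.
  - do 2 f_equal. symmetry. exact (minus_plus_cancel f g).
  - exact (pythagoras _ _ orth).
Qed.

Lemma norm_scal_sq {k : C -> C -> C} {H : RKHS k} (c : C) (f : H) :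
  (norm (scal c f) ^ 2 = Cmod c ^ 2 * norm f ^ 2)%R.
Proof.
  apply RtoC_inj.
  rewrite RtoC_mult, <- !inner_norm, inner_scal, inner_scal_r, Cmult_assoc.
  now rewrite <- Cmod2_conj, RtoC_pow.
Qed.

Lemma cauchy_schwarz {k : C -> C -> C} {H : RKHS k} (f g : H) :
  (Cmod (inner f g) <= norm f * norm g)%R.
Proof.
  destruct (Req_dec (norm g) 0) as [g0 | g0].
  - rewrite (inner_conj _ _ g f), Cmod_conj.
    replace g with (zero : H) by (symmetry; exact (norm_eq_zero (V := H) g g0)).
    rewrite inner_zero_l, Cmod_0.
    apply Rmult_le_pos; apply norm_ge_0.
  - assert (gpos : (0 < norm g)%R) by (pose proof (norm_ge_0 g); lra).
    set (c := inner f g).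
    (* Project [norm g ^ 2] times [f] on [g], so that nothing is divided by. *)
    assert (yg := pythagoras_minus (scal (RtoC (norm g ^ 2)) f) (scal c g)).
    rewrite inner_scal_r, inner_minus, !inner_scal, inner_norm in yg.
    specialize (yg ltac:(unfold c; ring)).
    rewrite !norm_scal_sq, Cmod_R, Rabs_pos_eq in yg by apply pow2_ge_0.
    apply Rsqr_incr_0_var.
    2:{ apply Rmult_le_pos; apply norm_ge_0. }
    apply Rmult_le_reg_r with (norm g ^ 2)%R; [nra |].
    unfold Rsqr.
    pose proof (pow2_ge_0 (norm (minus (scal (RtoC (norm g ^ 2)) f) (scal c g)))).
    nra.
Qed.

(** This and [eval_is_linear] allow a convergent series of vectors to be
    paired with a vector, or evaluated at a point, term by term: see
    [is_series_linear]. *)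
Lemma is_linear_inner {k : C -> C -> C} {H : RKHS k} (v : H) :
  is_linear (K := C_AbsRing) (V := C_NormedModule) (fun f : H => inner f v).
Proof.
  split.
  - intros x y. apply inner_plus.
  - intros c x. apply inner_scal.
  - exists (norm v + 1)%R. pose proof (norm_ge_0 v). split; [lra |].
    intros x. pose proof (cauchy_schwarz x v). pose proof (norm_ge_0 x).
    change (norm (inner x v)) with (Cmod (inner x v)). nra.
Qed.

(** * Series *)

Lemma linear_sum_n {U V : NormedModule C_AbsRing} (l : U -> V) (u : nat -> U) N :
  is_linear l -> l (sum_n u N) = sum_n (fun n => l (u n)) N.
Proof.
  intros hl. induction N as [| N IH].
  - now rewrite !sum_O.
  - now rewrite !sum_Sn, (linear_plus _ hl), IH.
Qed.

Lemma is_series_linear {U V : NormedModule C_AbsRing} (l : U -> V)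
    (u : nat -> U) (x : U) :
  is_linear l -> is_series u x -> is_series (fun n => l (u n)) (l x).
Proof.
  intros hl hu. unfold is_series.
  apply filterlim_ext with (fun N => l (sum_n u N)).
  { intros N. now apply linear_sum_n. }
  eapply filterlim_comp; [exact hu | now apply linear_cont].
Qed.

Lemma is_series_limit_unique {V : NormedModule C_AbsRing} (u : nat -> V) (x y : V) :
  is_series u x -> is_series u y -> x = y.
Proof. apply (filterlim_locally_unique (F := eventually)). Qed.

Lemma is_series_finite {V : NormedModule C_AbsRing} (u : nat -> V) (N : nat) :
  (forall n, (N < n)%nat -> u n = zero) -> is_series u (sum_n u N).
Proof.
  intros hu. unfold is_series.
  apply filterlim_ext_loc with (fun _ => sum_n u N); [| apply filterlim_const].
  exists N. intros n hn. induction hn as [| n hn IH]; [reflexivity |].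
  rewrite sum_Sn, <- IH, hu, plus_zero_r by lia. reflexivity.
Qed.

Lemma sum_n_incr (u : nat -> R) (N : nat) :
  (forall n, 0 <= u n)%R -> (sum_n u N <= sum_n u (S N))%R.
Proof.
  intros pos. rewrite sum_Sn. specialize (pos (S N)).
  change (plus (sum_n u N) (u (S N))) with (sum_n u N + u (S N))%R. lra.
Qed.

Lemma ex_series_nonneg_bounded (u : nat -> R) (M : R) :
  (forall n, 0 <= u n)%R -> (forall N, sum_n u N <= M)%R -> ex_series u.
Proof.
  intros pos bound.
  destruct (ex_finite_lim_seq_incr (sum_n u) M) as [l hl];
    [| exact bound | now exists l].
  intros n. now apply sum_n_incr.
Qed.

(** * Orthonormal expansions *)

Lemma norm_sum_sq {k : C -> C -> C} {H : RKHS k} (u : nat -> H) (p q : nat) :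
  (forall i j, i <> j -> inner (u i) (u j) = 0) ->
  (norm (sum_n_m u p q) ^ 2 = sum_n_m (fun n => norm (u n) ^ 2)%R p q)%R.
Proof.
  intros on.
  assert (null : (norm (zero : H) ^ 2 = 0)%R).
  { replace (norm (zero : H)) with 0%R; [ring |].
    symmetry. exact (norm_zero (V := H)). }
  assert (orth : forall q m, (q < m)%nat -> inner (sum_n_m u p q) (u m) = 0).
  { intros q' m. induction q' as [| q' IH]; intros hm.
    - destruct p as [| p].
      + rewrite sum_n_n. apply on. lia.
      + rewrite sum_n_m_zero by lia. apply inner_zero_l.
    - destruct (le_dec p (S q')).
      + rewrite sum_n_Sm, inner_plus, IH, on by lia. ring.
      + rewrite sum_n_m_zero by lia. apply inner_zero_l. }
  induction q as [| q IH].
  - destruct p as [| p]; [now rewrite !sum_n_n |].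
    now rewrite !sum_n_m_zero by lia.
  - destruct (le_dec p (S q)).
    + rewrite !sum_n_Sm, pythagoras, IH by (try apply orth; lia). reflexivity.
    + now rewrite !sum_n_m_zero by lia.
Qed.

Lemma norm_comb_sq {k : C -> C -> C} {H : RKHS k} (f : nat -> H) (c : nat -> C)
    (p q : nat) :
  orthonormal_basis f ->
  (norm (sum_n_m (fun n => scal (c n) (f n)) p q) ^ 2
     = sum_n_m (fun n => Cmod (c n) ^ 2)%R p q)%R.
Proof.
  intros [on _].
  transitivity (sum_n_m (fun n => norm (scal (c n) (f n)) ^ 2)%R p q).
  - apply (norm_sum_sq (fun n => scal (c n) (f n))). intros i j ij.
    rewrite inner_scal, inner_scal_r, on. destruct Nat.eq_dec; [lia | ring].
  - apply sum_n_m_ext. intros n. rewrite norm_scal_sq.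
    assert (e := on n n). rewrite inner_norm in e.
    destruct Nat.eq_dec; [| lia]. apply RtoC_inj in e. rewrite e, Rmult_1_r. reflexivity.
Qed.

Lemma inner_comb {k : C -> C -> C} {H : RKHS k} (f : nat -> H) (c : nat -> C)
    (N m : nat) :
  orthonormal_basis f ->
  inner (sum_n (fun n => scal (c n) (f n)) N) (f m)
    = if le_dec m N then c m else 0.
Proof.
  intros [on _].
  transitivity (sum_n (fun n => inner (scal (c n) (f n)) (f m)) N).
  { apply (linear_sum_n _ (fun n => scal (c n) (f n)) N (is_linear_inner (f m))). }
  induction N as [| N IH].
  - rewrite sum_O, inner_scal, on.
    destruct Nat.eq_dec as [<- |], le_dec; try lia; ring.
  - rewrite sum_Sn, IH, inner_scal, on.
    destruct Nat.eq_dec as [<- |], le_dec, le_dec; try lia; ring_C.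
Qed.

(** The residual of [g] after a partial sum [P] of its expansion is orthogonal to
    [P], so [norm P <= norm g]. *)
Lemma bessel {k : C -> C -> C} {H : RKHS k} (f : nat -> H) (g : H) :
  orthonormal_basis f -> ex_series (fun n => Cmod (inner g (f n)) ^ 2)%R.
Proof.
  intros hf.
  apply ex_series_nonneg_bounded with (norm g ^ 2)%R.
  - intros n. apply pow2_ge_0.
  - intros N. set (P := sum_n (fun n => scal (inner g (f n)) (f n)) N : H).
    assert (normP := norm_comb_sq f (fun n => inner g (f n)) 0 N hf).
    change (norm P ^ 2 = sum_n (fun n => Cmod (inner g (f n)) ^ 2)%R N)%R
      in normP.
    assert (orth : inner (minus g P) P = 0).
    { apply inner_0_sym.
      transitivity (sum_n (fun n =>
        inner (scal (inner g (f n)) (f n)) (minus g P)) N).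
      { exact (linear_sum_n _ _ _ (is_linear_inner (minus g P))). }
      transitivity (sum_n (fun _ => zero : C_NormedModule) N).
      - apply sum_n_ext_loc. intros n hn.
        rewrite inner_scal, (inner_0_sym (minus g P) (f n)).
        + ring_C.
        + etransitivity; [exact (inner_minus g P (f n)) |].
          unfold P. rewrite (inner_comb f (fun n => inner g (f n)) N n hf).
          destruct le_dec; [ring | lia].
      - exact (sum_n_m_const_zero (G := C_NormedModule) 0 N). }
    rewrite <- normP.
    assert (split := pythagoras_minus g P orth).
    pose proof (pow2_ge_0 (norm (minus g P))). lra.
Qed.

(** The Riesz-Fischer direction: orthogonality turns the Cauchy criterion for the
    squares into the Cauchy criterion in norm, and the space is complete. *)
Lemma synthesis {k : C -> C -> C} {H : RKHS k} (f : nat -> H) (c : nat -> C) :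
  orthonormal_basis f -> ex_series (fun n => Cmod (c n) ^ 2)%R ->
  exists h : H, is_series (fun n => scal (c n) (f n)) h /\
    forall m, inner h (f m) = c m.
Proof.
  intros hf hc.
  assert (ex : ex_series (fun n => scal (c n) (f n))).
  { apply ex_series_Cauchy. intros eps.
    apply (Cauchy_ex_series (K := R_AbsRing) (V := R_CompleteNormedModule)) in hc.
    assert (eps2 : (0 < eps ^ 2)%R) by (apply pow_lt, cond_pos).
    destruct (hc (mkposreal _ eps2)) as [N hN]. exists N. intros n m hn hm.
    specialize (hN n m hn hm).
    assert (sq := norm_comb_sq f c n m hf).
    set (x := norm (sum_n_m (fun n => scal (c n) (f n)) n m)) in *.
    assert (lt : (x ^ 2 < eps ^ 2)%R).
    { rewrite sq. exact (Rle_lt_trans _ _ _ (Rle_abs _) hN). }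
    pose proof (cond_pos eps).
    destruct (Rlt_le_dec x eps); [assumption | nra]. }
  destruct ex as [h hh]. exists h. split; [exact hh |]. intros m.
  apply (is_series_linear _ _ _ (is_linear_inner (f m))) in hh.
  apply (is_series_limit_unique _ _ _ hh).
  replace (c m) with (sum_n (fun n => inner (scal (c n) (f n)) (f m)) m).
  - apply (is_series_finite (V := C_NormedModule)). intros n hn.
    rewrite inner_scal, (proj1 hf).
    destruct Nat.eq_dec; [lia |]. ring_C.
  - transitivity (inner (sum_n (fun n => scal (c n) (f n)) m : H) (f m)).
    + symmetry. exact (linear_sum_n _ _ _ (is_linear_inner (f m))).
    + rewrite (inner_comb f c m m hf). destruct le_dec; [reflexivity | lia].
Qed.

(** A vector orthogonal to the whole basis is within any [eps] of a vector to which
    it is orthogonal, so its norm is at most [eps]. *)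
Lemma inner_ext {k : C -> C -> C} {H : RKHS k} (f : nat -> H) (g h : H) :
  orthonormal_basis f -> (forall n, inner g (f n) = inner h (f n)) -> g = h.
Proof.
  intros [_ dense] eq.
  set (x := minus g h).
  assert (xf : forall n, inner (f n) x = 0).
  { intros n. apply inner_0_sym. etransitivity; [exact (inner_minus g h (f n)) |].
    rewrite eq. ring. }
  assert (small : forall eps, (0 < eps -> norm x ^ 2 <= eps * norm x)%R).
  { intros eps he. destruct (dense x eps he) as (N & c & hN).
    set (P := sum_n (fun n => scal (c n) (f n)) N : H).
    change (norm (minus x P) < eps)%R in hN.
    assert (px : inner P x = 0).
    { transitivity (sum_n (fun n => inner (scal (c n) (f n)) x) N).
      { exact (linear_sum_n _ _ _ (is_linear_inner x)). }
      transitivity (sum_n (fun _ => zero : C_NormedModule) N).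
      - apply sum_n_ext. intros n. rewrite inner_scal, xf. ring_C.
      - exact (sum_n_m_const_zero (G := C_NormedModule) 0 N). }
    assert (split : inner (minus x P) x = RtoC (norm x ^ 2)).
    { etransitivity; [exact (inner_minus x P x) |].
      rewrite px, inner_norm. ring. }
    assert (cs : (Cmod (RtoC (norm x ^ 2)) <= norm (minus x P) * norm x)%R).
    { rewrite <- split. exact (cauchy_schwarz (minus x P) x). }
    rewrite Cmod_R, Rabs_pos_eq in cs by apply pow2_ge_0.
    pose proof (norm_ge_0 x). nra. }
  assert (x0 : norm x = 0%R).
  { pose proof (norm_ge_0 x). destruct (Req_dec (norm x) 0) as [| hx]; [assumption |].
    specialize (small (norm x / 2)%R). nra. }
  apply (norm_eq_zero (V := H)) in x0.
  transitivity (plus x h).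
  - symmetry. exact (minus_plus_cancel g h).
  - rewrite x0. exact (plus_zero_l (G := H) h).
Qed.

(** The sum of the expansion exists by [bessel] and [synthesis], and has the same
    coordinates as [g], so it is [g]. *)
Lemma expansion {k : C -> C -> C} {H : RKHS k} (f : nat -> H) (g : H) :
  orthonormal_basis f -> is_series (fun n => scal (inner g (f n)) (f n)) g.
Proof.
  intros hf. destruct (synthesis f _ hf (bessel f g hf)) as (g' & hg' & eq).
  now rewrite (inner_ext f g' g hf eq) in hg'.
Qed.

(** * Tridiagonal power series *)

(** The Taylor coefficients at [0] of the sum of [c n * (a n + b n * z) * z ^ n]. *)
Definition taylor (a b c : nat -> C) (n : nat) : C :=
  match n with
  | O => a O * c O
  | S n' => a n * c n + b n' * c n'
  end.

(** Grouping by powers of [w] leaves one boundary term, which [is_series_taylor]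
    shows to vanish in the limit. *)
Lemma sum_tridiagonal (a b c : nat -> C) (w : C) (N : nat) :
  sum_n (fun n => c n * ((a n + b n * w) * w ^ n)) N
    = sum_n (fun n => taylor a b c n * w ^ n) N + c N * (b N * w ^ S N).
Proof.
  induction N as [| N IH].
  - rewrite !sum_O. simpl. ring.
  - rewrite !sum_Sn, IH. simpl. ring_C.
Qed.

Lemma disc_opp (w : C) : disc w -> disc (- w).
Proof. unfold disc. now rewrite Cmod_opp. Qed.

Lemma basis_value_bound {k : C -> C -> C} {H : RKHS k} (f : nat -> H) (w : C) :
  orthonormal_basis f -> disc w ->
  exists B : R, forall n, (Cmod (eval (f n) w) <= B)%R.
Proof.
  intros [on _] hw. destruct (reproducing _ H w hw) as (kw & _ & rep).
  exists (norm kw). intros n. rewrite rep.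
  assert (unit : (norm (f n) = 1)%R).
  { assert (e := on n n). rewrite inner_norm in e.
    destruct Nat.eq_dec; [| lia]. apply RtoC_inj in e.
    pose proof (norm_ge_0 (f n)). nra. }
  pose proof (cauchy_schwarz (f n) kw). rewrite unit in *. lra.
Qed.

(** The hypotheses on [a] and [b] alone give no upper bound on the growth of
    [b n]. It comes from the values of [f n] at the opposite points [w] and [- w]:
    there the terms in [a n] cancel. *)
Lemma b_value_bound {k : C -> C -> C} {H : RKHS k} (a b : nat -> C) (f : nat -> H)
    (w : C) :
  semi_analytic_tridiagonal H a b f -> disc w ->
  exists B : R, forall n, (Cmod (b n * w ^ S n) <= B)%R.
Proof.
  intros hH hw.
  destruct (basis_value_bound f w (sat_basis _ _ _ _ hH) hw) as [B hB].
  destruct (basis_value_bound f (- w) (sat_basis _ _ _ _ hH) (disc_opp w hw))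
    as [B' hB'].
  exists ((B + B') / 2)%R. intros n. specialize (hB n). specialize (hB' n).
  rewrite (sat_eval _ _ _ _ hH) in hB, hB' by (try apply disc_opp; assumption).
  assert (opp : (- w) ^ n = (- (1)) ^ n * w ^ n).
  { rewrite <- Cpow_mult_l. f_equal. ring. }
  assert (sign : (- (1)) ^ n * (- (1)) ^ n = 1).
  { rewrite <- Cpow_mult_l. replace (- (1) * - (1)) with (RtoC 1) by ring.
    apply Cpow_1_l. }
  assert (modsign : (Cmod ((- (1)) ^ n) = 1)%R).
  { apply (f_equal Cmod) in sign. rewrite Cmod_mult, Cmod_1 in sign.
    pose proof (Cmod_ge_0 ((- (1)) ^ n)). nra. }
  assert (half : 2 * (b n * w ^ S n) =
    (a n + b n * w) * w ^ n - (- (1)) ^ n * ((a n + b n * - w) * (- w) ^ n)).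
  { rewrite opp. simpl.
    transitivity ((a n + b n * w) * w ^ n
      - (- (1)) ^ n * (- (1)) ^ n * ((a n - b n * w) * w ^ n)); [| ring].
    rewrite sign. ring. }
  apply (f_equal Cmod) in half. rewrite Cmod_mult, Cmod_R, Rabs_pos_eq in half by lra.
  pose proof (Cmod_triangle ((a n + b n * w) * w ^ n)
    (- ((- (1)) ^ n * ((a n + b n * - w) * (- w) ^ n)))) as tri.
  rewrite Cmod_opp, (Cmod_mult ((- (1)) ^ n)), modsign in tri.
  unfold Cminus in half. lra.
Qed.

Lemma eval_is_linear {k : C -> C -> C} {H : RKHS k} (w : C) :
  disc w -> is_linear (K := C_AbsRing) (V := C_NormedModule) (fun f : H => eval f w).
Proof.
  intros hw. destruct (reproducing _ H w hw) as (kw & _ & rep).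
  destruct (is_linear_inner kw) as [p s n].
  split.
  - intros x y. now apply eval_plus.
  - intros c x. now apply eval_scal.
  - destruct n as (M & hM & n). exists M. split; [assumption |].
    intros x. rewrite rep. apply n.
Qed.

Lemma square_summable_lim_0 (c : nat -> C) :
  ex_series (fun n => Cmod (c n) ^ 2)%R -> is_lim_seq (fun n => Cmod (c n)) 0%R.
Proof.
  intros hc. apply ex_series_lim_0 in hc.
  apply is_lim_seq_ext with (fun n => sqrt (Cmod (c n) ^ 2)).
  { intros n. rewrite sqrt_pow2; [reflexivity | apply Cmod_ge_0]. }
  rewrite <- sqrt_0 at 1.
  apply is_lim_seq_continuous; [apply continuity_pt_sqrt; lra | exact hc].
Qed.

(** The coordinates of [g] tend to [0] and [b n * w ^ S n] is bounded, so the
    boundary term of [sum_tridiagonal] vanishes in the limit. *)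
Lemma is_series_taylor {k : C -> C -> C} {H : RKHS k} (a b : nat -> C)
    (f : nat -> H) (g : H) (w : C) :
  semi_analytic_tridiagonal H a b f -> disc w ->
  is_series (V := C_NormedModule)
    (fun n => taylor a b (fun m => inner g (f m)) n * w ^ n) (eval g w).
Proof.
  intros hH hw. assert (hf := sat_basis _ _ _ _ hH).
  set (c := fun m => inner g (f m)).
  assert (main := is_series_linear _ _ _ (eval_is_linear w hw) (expansion f g hf)).
  destruct (b_value_bound a b f w hH hw) as [B hB].
  assert (tail : filterlim (fun N => - (c N * (b N * w ^ S N))) eventually
    (locally (zero : C_NormedModule))).
  { apply filterlim_norm_zero.
    change (is_lim_seq (fun N => Cmod (- (c N * (b N * w ^ S N)))) 0%R).
    apply is_lim_seq_le_le with (fun _ => 0%R) (fun N => Cmod (c N) * B)%R.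
    - intros N. rewrite Cmod_opp, Cmod_mult. pose proof (Cmod_ge_0 (c N)).
      pose proof (Cmod_ge_0 (b N * w ^ S N)). specialize (hB N). nra.
    - apply is_lim_seq_const.
    - replace 0%R with (0 * B)%R by ring.
      apply is_lim_seq_mult'; [| apply is_lim_seq_const].
      apply square_summable_lim_0, bessel, hf. }
  unfold is_series in main |- *.
  apply filterlim_ext with (fun N =>
    plus (sum_n (fun n => c n * ((a n + b n * w) * w ^ n)) N : C_NormedModule)
      (- (c N * (b N * w ^ S N)))).
  { intros N. rewrite sum_tridiagonal. set (s := sum_n _ N).
    change (s + c N * (b N * w ^ S N) - c N * (b N * w ^ S N) = s). ring. }
  replace (eval g w) with (plus (eval g w : C_NormedModule) zero)
    by apply plus_zero_r.
  eapply filterlim_comp_2; [| | apply (filterlim_plus (V := C_NormedModule))].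
  - eapply filterlim_ext; [| exact main]. intros N. apply sum_n_ext. intros n.
    simpl. rewrite eval_scal, (sat_eval _ _ _ _ hH) by assumption. reflexivity.
  - exact tail.
Qed.

(** * Coordinates of the shifted function *)

(** By convexity of the square, [(r * x + v) ^ 2] is at most
    [r * x ^ 2 + v ^ 2 / (1 - r)]. Summing this over [n] bounds
    [1 - r] times the sum of the [x n ^ 2] by [x 0 ^ 2] plus the sum of the
    [v n ^ 2 / (1 - r)]. *)
Lemma square_summable_recursion (x v : nat -> R) (r : R) :
  (0 <= r < 1)%R -> (forall n, 0 <= x n)%R ->
  (forall n, x (S n) <= r * x n + v n)%R ->
  ex_series (fun n => v n ^ 2)%R -> ex_series (fun n => x n ^ 2)%R.
Proof.
  intros hr hx step sv.
  assert (sq : forall n, (x (S n) ^ 2 <= r * x n ^ 2 + v n ^ 2 / (1 - r))%R).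
  { intros n. apply Rle_trans with ((r * x n + v n) ^ 2)%R.
    - specialize (step n). pose proof (hx (S n)). nra.
    - apply Rmult_le_reg_r with (1 - r)%R; [lra |].
      replace ((r * x n ^ 2 + v n ^ 2 / (1 - r)) * (1 - r))%R
        with ((r * x n ^ 2) * (1 - r) + v n ^ 2)%R by (field; lra).
      (* The two sides now differ by [r * ((1 - r) * x n - v n) ^ 2]. *)
      pose proof (Rmult_le_pos _ _ (proj1 hr) (pow2_ge_0 ((1 - r) * x n - v n))).
      nra. }
  destruct sv as [s hs].
  assert (le_s : forall N, (sum_n (fun n => v n ^ 2) N <= s)%R).
  { intros N. apply (is_lim_seq_incr_compare (sum_n (fun n => v n ^ 2)%R) s hs).
    intros n. apply sum_n_incr. intros n'. apply pow2_ge_0. }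
  assert (bound : forall N, ((1 - r) * sum_n (fun n => x n ^ 2) N + x (S N) ^ 2
    <= x O ^ 2 + sum_n (fun n => v n ^ 2) N / (1 - r))%R).
  { induction N as [| N IH].
    - rewrite !sum_O. specialize (sq O). lra.
    - rewrite !sum_Sn. specialize (sq (S N)).
      change (@plus R_AbelianMonoid) with Rplus. unfold Rdiv in *. lra. }
  apply ex_series_nonneg_bounded with ((x O ^ 2 + s / (1 - r)) / (1 - r))%R.
  { intros n. apply pow2_ge_0. }
  intros N. apply Rmult_le_reg_l with (1 - r)%R; [lra |].
  replace ((1 - r) * ((x O ^ 2 + s / (1 - r)) / (1 - r)))%R
    with (x O ^ 2 + s / (1 - r))%R by (field; lra).
  specialize (bound N). pose proof (pow2_ge_0 (x (S N))).
  assert (sum_n (fun n => v n ^ 2) N / (1 - r) <= s / (1 - r))%R.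
  { apply Rmult_le_compat_r; [left; apply Rinv_0_lt_compat; lra | apply le_s]. }
  lra.
Qed.

Lemma LimSup_lt_1_eventually (u : nat -> R) :
  (forall n, 0 <= u n)%R -> Rbar_lt (LimSup_seq u) 1%R ->
  exists r N, (0 <= r < 1)%R /\ forall n, (N <= n)%nat -> (u n <= r)%R.
Proof.
  intros pos lt. unfold LimSup_seq in lt.
  destruct (ex_LimSup_seq u) as [[l | |] hl]; simpl in lt; [| easy |].
  - assert (e : (0 < (1 - l) / 2)%R) by lra.
    destruct (proj2 (hl (mkposreal _ e))) as [N hN]. simpl in hN.
    exists ((1 + l) / 2)%R, N.
    assert (le : forall n, (N <= n)%nat -> (u n <= (1 + l) / 2)%R).
    { intros n hn. specialize (hN n hn). lra. }
    repeat split; try assumption; try lra.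
    apply Rle_trans with (u N); [apply pos | now apply le].
  - destruct (hl 0%R) as [N hN]. specialize (hN N (le_n N)).
    specialize (pos N). lra.
Qed.

(** Forward substitution in the bidiagonal system stating that the Taylor
    coefficients of the new sequence are [0] followed by those of [c]. *)
Fixpoint shift_coef (a b c : nat -> C) (n : nat) : C :=
  match n with
  | O => 0
  | S n' => (taylor a b c n' - b n' * shift_coef a b c n') / a n
  end.

Lemma taylor_shift_coef_0 (a b c : nat -> C) :
  taylor a b (shift_coef a b c) 0 = 0.
Proof. simpl. ring. Qed.

Lemma taylor_shift_coef_S (a b c : nat -> C) (n : nat) :
  a (S n) <> 0 -> taylor a b (shift_coef a b c) (S n) = taylor a b c n.
Proof. intros ha. simpl. now field. Qed.

(** Eliminating the Taylor coefficients, the driving term of the recursion is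
    [(a n / a (n + 1)) * (c n + (b (n - 1) / a n) * c (n - 1))], in which only
    ratios bounded by hypothesis occur. *)
Lemma square_summable_shift_coef {k : C -> C -> C} {H : RKHS k} (a b c : nat -> C)
    (f : nat -> H) :
  semi_analytic_tridiagonal H a b f -> ex_series (fun n => Cmod (c n) ^ 2)%R ->
  ex_series (fun n => Cmod (shift_coef a b c n) ^ 2)%R.
Proof.
  intros hH hc. assert (ha := sat_nonzero _ _ _ _ hH).
  destruct (sat_sup _ _ _ _ hH) as [M hM].
  destruct (LimSup_lt_1_eventually _ (fun n => Cmod_ge_0 _) (sat_limsup _ _ _ _ hH))
    as (r & N & hr & hN).
  assert (M0 : (0 <= M)%R) by (eapply Rle_trans; [apply Cmod_ge_0 | exact (hM O)]).
  set (h := shift_coef a b c).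
  apply (ex_series_incr_n (K := R_AbsRing) (V := R_NormedModule)
    (fun n => Cmod (h n) ^ 2)%R (S N)).
  apply (square_summable_recursion (fun j => Cmod (h (S N + j)%nat))
    (fun j => M * (Cmod (c (S N + j)%nat) + Cmod (c (N + j)%nat)))%R r hr).
  - intros j. apply Cmod_ge_0.
  - intros j. replace (S N + S j)%nat with (S (S (N + j))) by lia.
    replace (S N + j)%nat with (S (N + j)) by lia.
    assert (Nj : (N <= N + j)%nat) by lia. set (n := (N + j)%nat) in *.
    assert (step : h (S (S n)) = - (b (S n) / a (S (S n))) * h (S n)
      + (a (S n) / a (S (S n))) * (c (S n) + (b n / a (S n)) * c n)).
    { unfold h at 1. change (shift_coef a b c (S (S n))) with
        ((taylor a b c (S n) - b (S n) * h (S n)) / a (S (S n))).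
      simpl. field. split; apply ha. }
    rewrite step.
    apply Rle_trans with (1 := Cmod_triangle _ _).
    rewrite !Cmod_mult, Cmod_opp. apply Rplus_le_compat.
    + apply Rmult_le_compat_r; [apply Cmod_ge_0 | apply hN; lia].
    + apply Rmult_le_compat; try apply Cmod_ge_0; [apply hM |].
      apply Rle_trans with (1 := Cmod_triangle _ _).
      rewrite Cmod_mult. specialize (hN n Nj). pose proof (Cmod_ge_0 (c n)).
      nra.
  - apply (ex_series_le (K := R_AbsRing) (V := R_CompleteNormedModule)) with
      (fun j => 2 * M ^ 2 * (Cmod (c (S N + j)%nat) ^ 2 + Cmod (c (N + j)%nat) ^ 2))%R.
    + intros j.
      set (x := Cmod (c (S N + j)%nat)). set (y := Cmod (c (N + j)%nat)).
      change (Rabs ((M * (x + y)) ^ 2) <= 2 * M ^ 2 * (x ^ 2 + y ^ 2))%R.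
      rewrite Rabs_pos_eq by apply pow2_ge_0.
      pose proof (Rmult_le_pos _ _ (pow2_ge_0 M) (pow2_ge_0 (x - y))). nra.
    + apply (ex_series_scal (K := R_AbsRing) (V := R_NormedModule)).
      apply (ex_series_plus (K := R_AbsRing) (V := R_NormedModule)
        (fun j => Cmod (c (S N + j)%nat) ^ 2)%R (fun j => Cmod (c (N + j)%nat) ^ 2)%R).
      * exact (proj1 (ex_series_incr_n (K := R_AbsRing) (V := R_NormedModule) _ (S N)) hc).
      * exact (proj1 (ex_series_incr_n (K := R_AbsRing) (V := R_NormedModule) _ N) hc).
Qed.

(** Both sides have the same Taylor coefficients, once those of [g] are moved one
    place up. *)
Lemma eval_shift {k : C -> C -> C} {H : RKHS k} (a b : nat -> C) (f : nat -> H)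
    (g h : H) (z : C) :
  semi_analytic_tridiagonal H a b f ->
  (forall n, inner h (f n) = shift_coef a b (fun m => inner g (f m)) n) ->
  disc z -> eval h z = z * eval g z.
Proof.
  intros hH coef hz.
  assert (hs := is_series_taylor a b f h z hH hz).
  assert (gs := is_series_taylor a b f g z hH hz).
  set (c := fun m => inner g (f m)) in *.
  apply (is_series_limit_unique _ _ _ hs).
  apply (is_series_decr_1 (K := C_AbsRing) (V := C_NormedModule)).
  apply (is_series_scal (K := C_AbsRing) (V := C_NormedModule) z) in gs.
  assert (tay : forall n, taylor a b (fun m => inner h (f m)) n
    = taylor a b (shift_coef a b c) n).
  { intros [| n]; unfold taylor; now rewrite !coef. }
  rewrite tay, taylor_shift_coef_0.
  match goal with |- is_series _ ?l => replace l with (z * eval g z) end.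
  - eapply is_series_ext; [| exact gs]. intros n. cbv beta.
    rewrite tay, taylor_shift_coef_S by apply (sat_nonzero _ _ _ _ hH).
    change (z * (taylor a b c n * z ^ n) = taylor a b c n * z ^ S n). simpl. ring.
  - change (z * eval g z = z * eval g z - 0 * z ^ 0). ring.
Qed.

(** * The matrix of the left inverse *)

Lemma Cprod_S (u : nat -> C) (i l : nat) :
  Cprod u i (S l) = Cprod u i l * u (i + l)%nat.
Proof.
  unfold Cprod. rewrite List.seq_S, List.map_app, List.fold_right_app.
  simpl. set (l' := List.map u (List.seq i l)).
  induction l' as [| x l' IH]; simpl; [ring |]. rewrite IH. ring.
Qed.

Lemma Cprod_neq_0 (u : nat -> C) (i l : nat) :
  (forall n, u n <> 0) -> Cprod u i l <> 0.
Proof.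
  intros hu. induction l as [| l IH].
  - exact C1_nz.
  - rewrite Cprod_S. now apply Cmult_neq_0.
Qed.

(** Passing from row [m] to row [m + 1] adds the factors [- 1], [b m] and
    [/ a (m + 1)] to every entry on or below the diagonal, the diagonal entry
    included. *)
Lemma ell_step (a b : nat -> C) (m n : nat) :
  (forall n, a n <> 0) -> (n <= m)%nat ->
  ell a b (S m) n = - (b m / a (S m)) * ell a b m n.
Proof.
  intros ha le. unfold ell.
  destruct (Nat.eq_dec n (S (S m))); [lia |].
  destruct (Nat.eq_dec n (S m)); [lia |].
  destruct (Nat.eq_dec n 0); [ring |].
  destruct (lt_dec n (S m)); [| lia].
  destruct (Nat.eq_dec n m) as [-> |].
  - replace (S m - m)%nat with 1%nat by lia. rewrite !Cprod_S.
    unfold Cprod. simpl. rewrite !Nat.add_0_r. now field.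
  - destruct (lt_dec n m); [| lia].
    replace (S m - n)%nat with (S (m - n)) by lia. rewrite !Cprod_S.
    replace (n + (m - n))%nat with m by lia.
    replace (S n + (m - n))%nat with (S m) by lia.
    simpl. field. split; [now apply Cprod_neq_0 | apply ha].
Qed.

(** In row [m + 1] the entries up to column [m] contribute
    [- (b m / a (m + 1))] times what they contribute in row [m], which the
    induction hypothesis expresses by [c m] and [h (m + 1)]; the recursion
    defining [h] does the rest. *)
Lemma ell_row (a b c : nat -> C) (m : nat) :
  (forall n, a n <> 0) ->
  sum_n (fun n => shift_coef a b c n * ell a b m n) (S m) = c m.
Proof.
  intros ha. set (h := shift_coef a b c).
  assert (super : forall m, ell a b m (S m) = a (S m) / a m).
  { intros m'. unfold ell. now destruct Nat.eq_dec. }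
  assert (diag : forall m, ell a b (S m) (S m) = b (S m) / a (S m) - b m / a m).
  { intros m'. unfold ell, d_coef. destruct Nat.eq_dec; [lia |].
    destruct Nat.eq_dec; [lia |]. destruct Nat.eq_dec; [| lia].
    simpl. now rewrite Nat.sub_0_r. }
  induction m as [| m IH].
  - rewrite sum_Sn, sum_O, super. unfold h. simpl.
    replace (ell a b 0 0) with (RtoC 0) by reflexivity.
    change (@plus C_AbelianMonoid) with Cplus. field. split; apply ha.
  - rewrite sum_Sn in IH.
    rewrite !sum_Sn.
    rewrite (sum_n_ext_loc _ (fun n => - (b m / a (S m)) * (h n * ell a b m n)) m).
    2:{ intros n hn. rewrite ell_step by assumption. ring_C. }
    rewrite (sum_n_mult_l (K := C_Ring)).
    set (s := sum_n _ m) in *.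
    rewrite super, diag in *.
    change (s + h (S m) * (a (S m) / a m) = c m) in IH.
    change (- (b m / a (S m)) * s + h (S m) * (b (S m) / a (S m) - b m / a m)
      + h (S (S m)) * (a (S (S m)) / a (S m)) = c (S m)).
    replace s with (c m - h (S m) * (a (S m) / a m)) by (rewrite <- IH; ring).
    assert (rec : h (S (S m)) * a (S (S m))
      = a (S m) * c (S m) + b m * c m - b (S m) * h (S m)).
    { unfold h at 1. change (shift_coef a b c (S (S m))) with
       ((taylor a b c (S m) - b (S m) * h (S m)) / a (S (S m))).
      simpl. now field. }
    transitivity ((h (S (S m)) * a (S (S m)) - b m * c m + b (S m) * h (S m)) / a (S m)).
    + field. split; apply ha.
    + rewrite rec. now field.
Qed.

Lemma left_inverse_shift {k : C -> C -> C} {H : RKHS k} (a b : nat -> C)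
    (f : nat -> H) (L : H -> H) (g h : H) :
  semi_analytic_tridiagonal H a b f -> is_linear L ->
  (forall m n, inner (L (f n)) (f m) = ell a b m n) ->
  (forall n, inner h (f n) = shift_coef a b (fun m => inner g (f m)) n) ->
  L h = g.
Proof.
  intros hH hL hmat coef. assert (hf := sat_basis _ _ _ _ hH).
  apply (inner_ext f (L h) g hf). intros m.
  assert (hs := is_series_linear _ _ _ (is_linear_inner (f m))
    (is_series_linear _ _ _ hL (expansion f h hf))).
  apply (is_series_limit_unique _ _ _ hs).
  rewrite <- (ell_row a b (fun m => inner g (f m)) m (sat_nonzero _ _ _ _ hH)).
  eapply is_series_ext; [| apply (is_series_finite (V := C_NormedModule))].
  - intros n. cbv beta. rewrite <- coef, <- hmat.
    rewrite (linear_scal L hL). symmetry. apply inner_scal.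
  - intros n hn. cbv beta. unfold ell.
    destruct Nat.eq_dec; [lia |]. destruct Nat.eq_dec; [lia |].
    destruct Nat.eq_dec; [lia |]. destruct lt_dec; [lia |]. ring_C.
Qed.

Theorem theorem3p2 :
  forall (k : C -> C -> C)
    (hk_pos : positive_definite_kernel k)
    (hk_an : analytic_in_first_variable k)
    (H : RKHS k) (a b : nat -> C) (f : nat -> H)
    (hH : analytic_tridiagonal H a b f)
    (L : H -> H) (hL : is_linear L)
    (hmat : forall m n : nat, inner (L (f n)) (f m) = ell a b m n),
  exists Mz : H -> H, is_shift Mz /\ forall g : H, L (Mz g) = g.
Proof.
  intros k _ _ H a b f [hH _] L hL hmat.
  assert (hf := sat_basis _ _ _ _ hH).
  assert (zg : forall g : H, exists h : H, forall n,
    inner h (f n) = shift_coef a b (fun m => inner g (f m)) n).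
  { intros g.
    destruct (synthesis f (shift_coef a b (fun m => inner g (f m))) hf) as (h & _ & coef).
    - apply (square_summable_shift_coef a b _ f hH), bessel, hf.
    - now exists h. }
  exists (fun g => proj1_sig (constructive_indefinite_description _ (zg g))).
  split.
  - intros g z. apply (eval_shift a b f g); [exact hH |].
    apply (proj2_sig (constructive_indefinite_description _ (zg g))).
  - intros g. apply (left_inverse_shift a b f L g _ hH hL hmat).
    apply (proj2_sig (constructive_indefinite_description _ (zg g))).
Qed.
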